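(* Let $|q|<1$ and define integers $g_n,h_n$ by $$\sum_{n=0}^{\infty}g_nq^n=(q,q^4;q^5)_\infty(-q,-q^9;q^{10})_\infty^3,\qquad \sum_{n=0}^{\infty}h_nq^n=(q^2,q^3;q^5)_\infty(-q^3,-q^7;q^{10})_\infty^3.$$ Then $g_{5n+2}=0$ and $h_{5n+1}=0$ for all $n\ge0$.
   Context: For complex $a$ and $|q|<1$, $(a;q)_\infty=\prod_{k=0}^{\infty}(1-aq^k)$ and $(a_1,\dots,a_m;q)_\infty=(a_1;q)_\infty\cdots(a_m;q)_\infty$. *)

(* Defs.v *)
From HB Require Import structures.
From mathcomp Require Export all_boot all_order all_algebra.
From mathcomp Require Export complex.
From mathcomp Require Export all_classical all_reals all_analysis.
Export Order.TTheory GRing.Theory Num.Theory numFieldNormedType.Exports.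

Set Implicit Arguments.
Unset Strict Implicit.
Unset Printing Implicit Defensive.

Local Open Scope classical_set_scope.
Local Open Scope ring_scope.

(* Stated over an arbitrary numFieldType K, since MathComp-Analysis attaches the
   norm topology to K itself there, while R[i] has no topology of its own; the
   intended instance is K = R[i].  `limn` is an arbitrary value when there is no
   limit, but the partial products converge for every a as soon as `|q| < 1. *)
Definition qpochhammer (K : numFieldType) (a q : K) : K :=
  limn (fun n : nat => \prod_(0 <= k < n) (1 - a * q ^+ k)).

Definition qpochhammers (K : numFieldType) (s : seq K) (q : K) : K :=
  \prod_(a <- s) qpochhammer a q.

Definition generating_function (K : numFieldType) (c : nat -> int) (F : K -> K)
    : Prop :=
  forall q : K, `|q| < 1 ->
    series (fun n : nat => (c n)%:~R * q ^+ n) @ \oo --> F q.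

(* Main.v *)
Require Import Defs.
From mathcomp Require Import zify ring lra.

(** Multiplying either product by [(q^5; q^5) (q^10; q^10)^3], a series in
    [q^5] with constant term 1, does not affect which residue classes of exponents
    carry only zero coefficients.  By the Jacobi triple product it becomes
    [sum (-1)^a q^(e(a) + e'(b) + e'(c) + e'(d))] over integer quadruples, with [e] and
    [e'] quadratic.  On the quadruples whose exponent lies in the class in question an
    integral isometry of the quadratic form preserves the exponent and changes the
    parity of [a], so that the terms cancel in pairs.

    The triple product is only needed modulo [X^m], where it follows from the
    Gaussian binomial theorem for polynomials.  The coefficients of the analytic
    product are those of its partial products, since at small real [r] the two differ
    by [O(r^N)]. *)

Set Implicit Arguments.
Unset Strict Implicit.
Unset Printing Implicit Defensive.

Local Open Scope classical_set_scope.
Local Open Scope ring_scope.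

(** * Gaussian binomials and the truncated triple product *)

Section GaussianBinomial.
Variables (A : comNzRingType) (q : A).

Fixpoint gbin (n k : nat) : A :=
  match n, k with
  | _, 0 => 1
  | 0, _.+1 => 0
  | n'.+1, k'.+1 => gbin n' k' + q ^+ k * gbin n' k
  end.

Definition qfact (n : nat) : A := \prod_(i < n) (1 - q ^+ i.+1).

Lemma gbin0 n : gbin n 0 = 1. Proof. by case: n. Qed.

Lemma gbinS n k : gbin n.+1 k.+1 = gbin n k + q ^+ k.+1 * gbin n k.+1.
Proof. by []. Qed.

Lemma gbin_small n k : (n < k)%N -> gbin n k = 0.
Proof.
elim: n k => [|n IHn] [|k] //; rewrite ltnS => nk.
by rewrite gbinS !IHn ?mulr0 ?addr0 // ltnW.
Qed.

Lemma qfactS n : qfact n.+1 = qfact n * (1 - q ^+ n.+1).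
Proof. by rewrite /qfact big_ord_recr. Qed.

(** Division-free form of the quotient of q-factorials. The induction rests on [1 - q^(n+1) = (1 -
    q^(k+1)) + q^(k+1) (1 - q^(n-k))]. *)
Lemma gbin_qfact n k : (k <= n)%N ->
  gbin n k * qfact k * qfact (n - k) = qfact n.
Proof.
have qfact0 : qfact 0 = 1 by rewrite /qfact big_ord0.
elim: n k => [|n IHn] [|k]; rewrite ?gbin0 ?qfact0 ?subn0 ?mul1r //.
rewrite ltnS gbinS subSS leq_eqVlt => /predU1P[->|kn].
  rewrite (gbin_small (ltnSn n)) mulr0 addr0 subnn qfact0 mulr1 !qfactS mulrA.
  by rewrite -[in RHS](IHn n) // subnn qfact0 mulr1.
have nkE : (n - k = (n - k.+1).+1)%N by lia.
have IH1 := IHn k (ltnW kn); have IH2 := IHn k.+1 kn.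
have -> : (gbin n k + q ^+ k.+1 * gbin n k.+1) * qfact k.+1 * qfact (n - k) =
  gbin n k * qfact k * qfact (n - k) * (1 - q ^+ k.+1) +
  q ^+ k.+1 * (gbin n k.+1 * qfact k.+1 * qfact (n - k.+1)) * (1 - q ^+ (n - k)).
  by rewrite (qfactS k) nkE (qfactS (n - k.+1)); ring.
rewrite IH1 IH2 qfactS.
have -> : q ^+ n.+1 = q ^+ k.+1 * q ^+ (n - k) by rewrite -exprD; congr (_ ^+ _); lia.
by ring.
Qed.

(** The q-binomial theorem, homogeneous in [x] and [y] so that a power of [q] can later serve as [y]
    in place of negative exponents. The induction splits off the factor [k = 0] and uses the case
    [x q]. *)
Lemma rothe n (x y : A) :
  \prod_(k < n) (y + x * q ^+ k) =
  \sum_(k < n.+1) q ^+ 'C(k, 2) * gbin n k * x ^+ k * y ^+ (n - k).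
Proof.
elim: n x => [|n IHn] x; first by rewrite big_ord0 big_ord1 /= !mulr1.
rewrite big_ord_recl expr0 mulr1.
under eq_bigr => i _ do rewrite /= /bump add1n exprS mulrA.
rewrite IHn mulrDl [in RHS]big_ord_recl [in RHS]big_ord_recr /=.
rewrite (gbin_small (ltnSn n)) mulr0 addr0 /bump add1n subnn.
rewrite [X in y * X]big_ord_recl [X in _ + x * X]big_ord_recr /=.
rewrite !gbin0 bin0n !subn0 !mulr1 !expr0 !mul1r.
rewrite mulrDr -exprS -addrA; congr (_ + _).
rewrite mulrDr addrA; congr (_ + _); last first.
  by rewrite subnn binS bin1 exprMn exprD [x ^+ n.+1]exprS; ring.
rewrite !mulr_sumr -big_split /=; apply: eq_bigr => i _.
rewrite /bump !add1n subSS binS bin1 exprD !exprMn.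
have -> : (n - i = (n - i.+1).+1)%N by have := ltn_ord i; lia.
by rewrite !exprS; ring.
Qed.
End GaussianBinomial.

(** * Congruence of integer polynomials modulo [X^m] *)

Definition eqmodX (m : nat) (p r : {poly int}) : Prop :=
  forall i, (i < m)%N -> p`_i = r`_i.

Lemma eqmodXx m p : eqmodX m p p. Proof. by []. Qed.

Lemma eqmodX_sym m p r : eqmodX m p r -> eqmodX m r p.
Proof. by move=> pr i im; rewrite pr. Qed.

Lemma eqmodX_trans m p2 p1 p3 :
  eqmodX m p1 p2 -> eqmodX m p2 p3 -> eqmodX m p1 p3.
Proof. by move=> p12 p23 i im; rewrite p12 // p23. Qed.

Lemma eqmodXM m p1 p2 r1 r2 :
  eqmodX m p1 p2 -> eqmodX m r1 r2 -> eqmodX m (p1 * r1) (p2 * r2).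
Proof.
move=> p12 r12 i im; rewrite !coefM; apply: eq_bigr => j _.
by have := ltn_ord j => ji; rewrite p12 ?r12 //; lia.
Qed.

Lemma eqmodX_sum m (I : finType) (F G : I -> {poly int}) :
  (forall i, eqmodX m (F i) (G i)) -> eqmodX m (\sum_i F i) (\sum_i G i).
Proof. by move=> FG i im; rewrite !coef_sum; apply: eq_bigr => j _; apply: FG. Qed.

Lemma eqmodX_Xn m n p : (m <= n)%N -> eqmodX m ('X^n * p) 0.
Proof. by move=> mn i im; rewrite coefXnM coef0 (leq_trans im mn). Qed.

(** A factor with constant term 1 is invertible modulo [X^m]: degree by degree, the product
    determines the cofactor. *)
Lemma eqmodX_mulIl m (p r1 r2 : {poly int}) : p`_0 = 1 ->
  eqmodX m (p * r1) (p * r2) -> eqmodX m r1 r2.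
Proof.
move=> p0 pr i; have [n] := ubnP i; elim: n i => // n IHn i; rewrite ltnS => lein im.
have := pr i im; rewrite !coefM !big_ord_recl /= p0 !mul1r !subn0.
rewrite (_ : \sum_(j < i) _ = \sum_(j < i) p`_(lift ord0 j) * r2`_(i - lift ord0 j)).
  exact: addIr.
apply: eq_bigr => j _; rewrite IHn //; have := ltn_ord j;
  by rewrite /= /bump add1n => ji; lia.
Qed.

(** * The Jacobi triple product in finite form and modulo [X^m] *)

Section FiniteTripleProduct.
Variables (u w : nat) (c : {poly int}).
Hypothesis cc : c * c = 1.
Let b := (u + w)%N.

(* The exponent [u j + b (j^2 - j) / 2], split on the sign of [j] so that it is a
   natural number by construction. *)
Definition theta_exp (j : int) : nat :=
  match j with
  | Posz n => u * n + b * 'C(n, 2)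
  | Negz n => w * n.+1 + b * 'C(n.+1, 2)
  end%N.

Lemma bin2D (m n : nat) : 'C(m + n, 2) = ('C(m, 2) + 'C(n, 2) + m * n)%N.
Proof.
elim: m => [|m IHm]; first by rewrite mul0n addn0.
by rewrite addSn !binS !bin1 IHm; lia.
Qed.

Lemma theta_expN (n : nat) : theta_exp (- n%:Z) = (w * n + b * 'C(n, 2))%N.
Proof. by case: n => [|n]; rewrite ?NegzE //= !muln0. Qed.

Lemma theta_expE (j : int) :
  2 * (theta_exp j)%:Z = 2 * u%:Z * j + b%:Z * (j * j - j).
Proof.
have bin2E n : 2 * 'C(n, 2)%:Z = n%:Z * n%:Z - n%:Z :> int.
  by elim: n => // n IHn; rewrite binS bin1; lia.
case: j => n.
  by rewrite /theta_exp PoszD !PoszM mulrDr [2 * (b%:Z * _)]mulrCA bin2E; ring.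
rewrite NegzE theta_expN /b !PoszD !PoszM mulrDr [2 * ((u + w)%:Z * _)]mulrCA bin2E.
by rewrite PoszD; ring.
Qed.

Lemma theta_exp_ge (j : int) : (0 < u)%N -> (0 < w)%N -> (`|j| <= theta_exp j)%N.
Proof.
move=> u0 w0; case: j => n; rewrite ?NegzE ?theta_expN ?abszN /=;
  by apply: leq_trans (leq_addr _ _); apply: leq_pmull.
Qed.

(** Matches the exponents of the two sides of [finite_triple_product] once its prefactor is
    multiplied in. *)
Lemma theta_exp_shift (N k : nat) : (k <= 2 * N)%N ->
  (u * N + b * 'C(N, 2) + b * N * N + theta_exp (k%:Z - N%:Z) =
   b * 'C(k, 2) + u * k + b * N * (2 * N - k))%N.
Proof.
move=> k2N; case: (leqP N k) => Nk.
  have [j kE] : exists j, (k = N + j)%N by exists (k - N)%N; lia.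
  have -> : k%:Z - N%:Z = j%:Z by lia.
  rewrite /theta_exp kE bin2D.
  have [i NE] : exists i, (N = j + i)%N by exists (N - j)%N; lia.
  have -> : (2 * N - (N + j) = i)%N by lia.
  by rewrite NE; ring.
have [j NE] : exists j, (N = k + j)%N by exists (N - k)%N; lia.
have -> : k%:Z - N%:Z = - j%:Z by lia.
rewrite theta_expN NE bin2D.
have -> : (2 * (k + j) - k = k + j + j)%N by lia.
have jj : (j * j = 2 * 'C(j, 2) + j)%N.
  by elim: (j) => // i IHi; rewrite binS bin1; lia.
transitivity (u * k + b * 'C(k, 2) + b * (k + j) * (k + j) + b * k * j +
              b * (2 * 'C(j, 2) + j))%N; first by rewrite /b; ring.
by rewrite -jj; ring.
Qed.

Definition theta_prod (N : nat) : {poly int} :=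
  \prod_(k < N) ((1 + c * 'X^(b * k + u)) * (1 + c * 'X^(b * k + w))).

Lemma prod_geometric N :
  \prod_(k < N) (c * 'X^(b * k + u)) = c ^+ N * 'X^(u * N + b * 'C(N, 2)).
Proof.
elim: N => [|N IHN]; first by rewrite big_ord0 !muln0 !expr0 mulr1.
rewrite big_ord_recr IHN /= mulrACA -exprSr -exprD binS bin1.
by congr (_ * 'X^_); ring.
Qed.

(** This is [rothe] with [2N] factors, [y = X^(bN)] and [x = c X^u], recentred at [k = N]. The
    prefactor cancelled first in the proof avoids negative powers of [X]. *)
Lemma finite_triple_product N :
  theta_prod N = \sum_(k < (2 * N).+1)
    c ^+ (N + k) * 'X^(theta_exp (k%:Z - N%:Z)) * gbin 'X^b (2 * N) k.
Proof.
have cX0 M : c ^+ N * 'X^M != 0 :> {poly int}.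
  rewrite mulf_neq0 ?expf_neq0 ?polyX_eq0 //.
  by apply/eqP => c0; move: cc; rewrite c0 mul0r => /esym/eqP; rewrite oner_eq0.
apply: (mulfI (cX0 (u * N + b * 'C(N, 2) + b * N * N)%N)).
(* Factor [N + k] is [X^(bN) (1 + c X^(bk+u))]; factor [N - 1 - k] is
   [c X^(b(N-1-k)+u) (1 + c X^(bk+w))], because [c c = 1] and [b = u + w]. *)
transitivity (\prod_(k < 2 * N) ('X^(b * N) + (c * 'X^u) * 'X^b ^+ k) : {poly int}).
  rewrite mul2n -addnn big_split_ord /= exprD mulrA -prod_geometric.
  rewrite [X in _ = X * _](reindex_inj rev_ord_inj) [X in X * _ * _](reindex_inj rev_ord_inj) /=.
  rewrite exprM -[X in 'X^(b * N) ^+ X](card_ord N) -prodr_const.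
  rewrite /theta_prod -!big_split /=; apply: eq_bigr => k _.
  have kN := ltn_ord k.
  have XNE : 'X^(b * N) = 'X^(b * (N - k.+1) + u) * 'X^(b * k + w) :> {poly int}.
    rewrite -exprD; congr 'X^_.
    have [i NE] : exists i, (N = k + i.+1)%N by exists (N - k.+1)%N; lia.
    rewrite {1}NE (_ : N - k.+1 = i)%N; last by lia.
    by rewrite /b; ring.
  rewrite [X in _ * X = _]mulrC mulrACA mulrC [in RHS]mulrC -!exprM mulnDr; congr (_ * _).
    by rewrite !exprD; ring.
  rewrite mulrDr mulr1 mulrACA cc mul1r -XNE addrC; congr (_ + _).
  by rewrite exprD; ring.
rewrite rothe mulr_sumr; apply: eq_bigr => k _.
have k2N : (k <= 2 * N)%N by rewrite -ltnS ltn_ord.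
rewrite -!exprM exprMn -exprM.
have -> : c ^+ N * 'X^(u * N + b * 'C(N, 2) + b * N * N) *
  (c ^+ (N + k) * 'X^(theta_exp (k%:Z - N%:Z)) * gbin 'X^b (2 * N) k) =
  (c * c) ^+ N * c ^+ k *
  'X^(u * N + b * 'C(N, 2) + b * N * N + theta_exp (k%:Z - N%:Z)) *
  gbin 'X^b (2 * N) k.
  by rewrite exprMn !exprD; ring.
by rewrite cc expr1n theta_exp_shift // !exprD; ring.
Qed.

(** The bilateral theta series cut to [-N <= j <= N], with [j = k - N]; the sign [c^(N+k)] is [c^j]
    since [c c = 1]. *)
Definition theta_sum (N : nat) : {poly int} :=
  \sum_(k < (2 * N).+1) c ^+ (N + k) * 'X^(theta_exp (k%:Z - N%:Z)).

Hypotheses (u0 : (0 < u)%N) (w0 : (0 < w)%N).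

Lemma qfact_coef0 m : (qfact 'X^b m : {poly int})`_0 = 1.
Proof.
elim: m => [|m IHm]; first by rewrite /qfact big_ord0 coef1.
rewrite qfactS coef0M IHm mul1r coefB coef1 -exprM coefXn.
by rewrite (_ : (0 == b * m.+1)%N = false) ?subr0 // /b; nia.
Qed.

Lemma qfact_eqmodX m n : (m <= n)%N ->
  eqmodX m (qfact 'X^b n) (qfact 'X^b m).
Proof.
elim: n => [|n IHn]; first by rewrite leqn0 => /eqP->.
rewrite leq_eqVlt => /predU1P[->//|]; rewrite ltnS => mn.
apply: eqmodX_trans (IHn mn); rewrite qfactS mulrBr mulr1 => i im.
rewrite coefB mulrC -exprM (eqmodX_Xn (m := m)) ?coef0 ?subr0 //.
by rewrite (leq_trans mn) // /b; nia.
Qed.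

(** Modulo [X^m] the [qfact] at [n], [k] and [n - k] all agree with that at [m], so one copy cancels
    in [gbin_qfact]. *)
Lemma gbin_eqmodX m n k : (m <= k)%N -> (m + k <= n)%N ->
  eqmodX m (qfact 'X^b m * gbin 'X^b n k) 1.
Proof.
move=> mk mkn; apply: (eqmodX_mulIl (qfact_coef0 m)).
have kn : (k <= n)%N by lia.
rewrite mulr1; apply: eqmodX_trans (qfact_eqmodX (_ : m <= n)%N); last by lia.
rewrite -(gbin_qfact 'X^b kn) mulrA mulrC mulrA.
by apply/eqmodX_sym/eqmodXM; [apply: eqmodXM => //|]; apply: qfact_eqmodX; lia.
Qed.

(** With half-width [2m], each [k] either meets the bounds of [gbin_eqmodX] or has [|k - 2m| > m],
    in which case both terms vanish modulo [X^m]. *)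
Lemma theta_prod_eqmodX m :
  eqmodX m (qfact 'X^b m * theta_prod (2 * m)) (theta_sum (2 * m)).
Proof.
rewrite finite_triple_product mulr_sumr; apply: eqmodX_sum => k.
have k4m : (k <= 2 * (2 * m))%N by rewrite -ltnS.
rewrite mulrCA -[in X in eqmodX _ _ X](mulr1 (c ^+ _ * _)).
case: (boolP ((m <= k)%N && (m + k <= 2 * (2 * m))%N)) => [/andP[mk mk4]|far].
  by apply: eqmodXM; [exact: eqmodXx | exact: gbin_eqmodX].
have mexp : (m <= theta_exp (k%:Z - (2 * m)%:Z))%N.
  by apply: leq_trans (theta_exp_ge _ u0 w0); lia.
rewrite !(mulrC (c ^+ _)) -!mulrA.
by apply: eqmodX_trans (eqmodX_sym _); apply: eqmodX_Xn.
Qed.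

End FiniteTripleProduct.

Lemma sum_sign_reversing (I : finType) (P : pred I) (F : I -> int) (t : I -> I) :
  (forall x, P x -> P (t x)) -> (forall x, P x -> t (t x) = x) ->
  (forall x, P x -> F (t x) = - F x) ->
  \sum_(x | P x) F x = 0.
Proof.
move=> Pt tt Ft.
suff : \sum_(x | P x) F x = - \sum_(x | P x) F x by lia.
rewrite {1}(reindex_onto t t) // -sumrN; apply: eq_big => x => [|/andP[Ptx /eqP ttx]].
  apply/idP/idP => [/andP[Ptx /eqP<-]|Px]; first exact: Pt.
  by rewrite Pt // tt /=.
by apply: Ft; rewrite -ttx; exact: Pt.
Qed.

(** * Cancellation in the fourfold theta sums *)

Section Quadruples.
Variables (u w u' w' : nat).

Definition quad_exp (x : int * int * int * int) : nat :=
  let: (a, b, c, d) := x in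
  (theta_exp u w a + theta_exp u' w' b + theta_exp u' w' c + theta_exp u' w' d)%N.

Lemma theta_sum4_coef N i :
  (theta_sum u w (-1) N * theta_sum u' w' 1 N ^+ 3)`_i =
  \sum_(x : 'I_(2 * N).+1 * 'I_(2 * N).+1 * 'I_(2 * N).+1 * 'I_(2 * N).+1 |
      quad_exp (x.1.1.1%:Z - N%:Z, x.1.1.2%:Z - N%:Z, x.1.2%:Z - N%:Z, x.2%:Z - N%:Z)
      == i) (-1) ^+ (N + x.1.1.1).
Proof.
rewrite !exprS expr0 mulr1 !mulrA /theta_sum.
do 3 rewrite big_distrlr /= pair_bigA /=.
rewrite coef_sum [RHS]big_mkcond /=; apply: eq_bigr => -[[[a b] c] d] _ /=.
rewrite !expr1n !mul1r -!mulrA -!exprD !addnA eq_sym.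
rewrite -[(-1) ^+ (N + a) in LHS]signr_odd -[(-1) ^+ (N + a) in RHS]signr_odd.
rewrite mulr_sign.
by case: odd; rewrite ?coefN coefXn; case: eqP.
Qed.

Hypotheses (u0 : (0 < u)%N) (w0 : (0 < w)%N) (u'0 : (0 < u')%N) (w'0 : (0 < w')%N).

(** By [theta_exp_ge], [i <= N] puts every integer quadruple of exponent [i] inside the truncation
    box, so an involution of integer quadruples restricts to the finite index set. *)
Lemma theta_sum4_coef_eq0 N i (t : int * int * int * int -> int * int * int * int) :
  (i <= N)%N ->
  (forall x, quad_exp x = i ->
    [/\ quad_exp (t x) = i, t (t x) = x & odd `|(t x).1.1.1 - x.1.1.1|]) ->
  (theta_sum u w (-1) N * theta_sum u' w' 1 N ^+ 3)`_i = 0.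
Proof.
move=> iN tP; rewrite theta_sum4_coef.
pose toZ (k : 'I_(2 * N).+1) : int := k%:Z - N%:Z.
pose ofZ (j : int) : 'I_(2 * N).+1 := inord `|j + N%:Z|.
have toZK : cancel toZ ofZ.
  by move=> k; rewrite /ofZ /toZ subrK inord_val.
have ofZK j : (`|j| <= N)%N -> toZ (ofZ j) = j.
  by move=> jN; rewrite /toZ /ofZ inordK; lia.
pose to4 (x : 'I_(2 * N).+1 * 'I_(2 * N).+1 * 'I_(2 * N).+1 * 'I_(2 * N).+1) :=
  (toZ x.1.1.1, toZ x.1.1.2, toZ x.1.2, toZ x.2).
pose of4 (y : int * int * int * int) :=
  (ofZ y.1.1.1, ofZ y.1.1.2, ofZ y.1.2, ofZ y.2).
have to4K : cancel to4 of4.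
  by move=> [[[a b] c] d]; rewrite /to4 /of4 /= !toZK.
have of4K y : quad_exp y = i -> to4 (of4 y) = y.
  case: y => [[[a b] c] d] /= yi; rewrite /to4 /of4 /=.
  have := theta_exp_ge a u0 w0; have := theta_exp_ge b u'0 w'0.
  have := theta_exp_ge c u'0 w'0; have := theta_exp_ge d u'0 w'0.
  by move=> d_le c_le b_le a_le; rewrite !ofZK //; lia.
apply: (@sum_sign_reversing _ _ _ (of4 \o t \o to4)) => x /eqP;
  rewrite -[X in quad_exp X]/(to4 x) => xi; have [txi ttx odd_t] := tP _ xi.
- by apply/eqP; rewrite -[X in quad_exp X]/(to4 (of4 (t (to4 x)))) of4K.
- by rewrite /= of4K // ttx to4K.
- have aE : toZ (of4 (t (to4 x))).1.1.1 = (t (to4 x)).1.1.1.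
    by rewrite -[RHS](congr1 (fun z => z.1.1.1) (of4K _ txi)).
  have parity (o o' : nat) : odd `|(o%:Z - N%:Z - (o'%:Z - N%:Z))%R|%N ->
    odd (N + o) = ~~ odd (N + o') by lia.
  move: odd_t; rewrite -aE => /parity odd_t.
  by rewrite -signr_odd -[in RHS]signr_odd odd_t; case: odd.
Qed.

End Quadruples.

(** * Removing factors supported on the multiples of [d] *)

Lemma qfact_coef_notdvd b d m i : (d %| b)%N -> ~~ (d %| i)%N ->
  (qfact 'X^b m : {poly int})`_i = 0.
Proof.
move=> db; elim: m i => [|m IHm] i di.
  rewrite /qfact big_ord0 coef1.
  by case: eqP di => // ->; rewrite dvdn0.
rewrite qfactS mulrBr mulr1 -exprM coefB coefMXn IHm // sub0r.
case: ltnP => [|bi]; rewrite ?oppr0 // IHm ?oppr0 // dvdn_subl //.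
by rewrite dvdn_mulr.
Qed.

Section Dissection.
Variable d : nat.

Definition supp_mul (p : {poly int}) := forall i, ~~ (d %| i)%N -> p`_i = 0.

Lemma supp_mulM p r : supp_mul p -> supp_mul r -> supp_mul (p * r).
Proof.
move=> p_d r_d i di; rewrite coefM big1 // => j _.
have [dj|/p_d->] := boolP (d %| j)%N; last by rewrite mul0r.
have ji : (j <= i)%N by rewrite -ltnS.
by rewrite r_d ?mulr0 // dvdn_subl // dvdn_addl.
Qed.

(** The coefficient of [p * r] at [i] is that of [r] plus multiples of earlier coefficients of [r]
    in the same residue class, so strong induction applies. *)
Lemma coef_eq0_of_supp_mul (p r : {poly int}) m c : p`_0 = 1 -> supp_mul p ->
  (forall i, (i < m)%N -> i = c %[mod d] -> (p * r)`_i = 0) ->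
  forall i, (i < m)%N -> i = c %[mod d] -> r`_i = 0.
Proof.
move=> p0 p_d pr0 i; have [n] := ubnP i; elim: n i => // n IHn i.
rewrite ltnS => lein im ic; have := pr0 i im ic.
rewrite coefM big_ord_recl /= p0 mul1r subn0 big1 ?addr0 // => j _.
have ji := ltn_ord j; rewrite /= /bump add1n.
have [dj|/p_d->] := boolP (d %| j.+1)%N; last by rewrite mul0r.
rewrite IHn ?mulr0 //; [lia|lia|].
by rewrite -ic -[in RHS](subnK ji) -modnDmr (eqP dj) addn0.
Qed.
End Dissection.

(** Multiplication by [E1 * E2^3] turns the products into theta sums modulo [X^m]; this factor is
    supported on multiples of 5 and can be removed again. *)
Lemma theta_prod4_coef_eq0 (u w u' w' m c : nat) :
  (0 < u)%N -> (0 < w)%N -> (0 < u')%N -> (0 < w')%N ->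
  (5 %| u + w)%N -> (5 %| u' + w')%N ->
  (forall i, (i < m)%N -> i = c %[mod 5] ->
    (theta_sum u w (-1) (2 * m) * theta_sum u' w' 1 (2 * m) ^+ 3)`_i = 0) ->
  forall i, (i < m)%N -> i = c %[mod 5] ->
    (theta_prod u w (-1) (2 * m) * theta_prod u' w' 1 (2 * m) ^+ 3)`_i = 0.
Proof.
move=> u0 w0 u'0 w'0 d5 d5' theta0.
pose E1 : {poly int} := qfact 'X^(u + w) m.
pose E2 : {poly int} := qfact 'X^(u' + w') m.
have N1N1 : -1 * -1 = 1 :> {poly int} by rewrite mulrNN mulr1.
have E1_5 : supp_mul 5 E1 by move=> i; exact: qfact_coef_notdvd.
have E2_5 : supp_mul 5 E2 by move=> i; exact: qfact_coef_notdvd.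
apply: (@coef_eq0_of_supp_mul 5 (E1 * (E2 * (E2 * E2)))).
- by rewrite !coef0M !qfact_coef0 // !mulr1.
- exact: supp_mulM E1_5 (supp_mulM E2_5 (supp_mulM E2_5 E2_5)).
move=> i im ic; rewrite -[RHS](theta0 i im ic) !exprS expr0 !mulr1.
set T1 := theta_prod u w _ _; set T2 := theta_prod u' w' _ _.
have -> : E1 * (E2 * (E2 * E2)) * (T1 * (T2 * (T2 * T2))) =
  E1 * T1 * (E2 * T2 * (E2 * T2 * (E2 * T2))) by ring.
have E2T2 : eqmodX m (E2 * T2) (theta_sum u' w' 1 (2 * m)).
  by apply: theta_prod_eqmodX; rewrite ?mulr1.
suff E : eqmodX m (E1 * T1) (theta_sum u w (-1) (2 * m)).
  exact: (eqmodXM E (eqmodXM E2T2 (eqmodXM E2T2 E2T2))).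
exact: theta_prod_eqmodX.
Qed.

(* Modulo 5 the exponent is [a + b + c + d].  On [a + b + c + d = 5 k + 2] the map
   below is minus the reflection in the vector (4, 1, 1, 1) for the quadratic form
   [x^2 + 8 (y^2 + z^2 + t^2)] at [x = 10 a - 3], [y = 5 b - 2], and so on. *)
Lemma theta_sum_g_coef_eq0 N i : (i <= N)%N -> i = 2 %[mod 5] ->
  (theta_sum 1 4 (-1) N * theta_sum 1 9 1 N ^+ 3)`_i = 0.
Proof.
move=> iN i2.
pose k (x : int * int * int * int) :=
  let: (a, b, c, d) := x in ((a + b + c + d - 2) %/ 5)%Z.
pose t (x : int * int * int * int) :=
  let: (a, b, c, d) := x in
  (1 + 4 * k x - a, 1 + 2 * k x - b, 1 + 2 * k x - c, 1 + 2 * k x - d).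
apply: (@theta_sum4_coef_eq0 _ _ _ _ _ _ _ _ _ _ t) => // -[[[a b] c] d] /= xi.
have := theta_expE 1 4 a; have := theta_expE 1 9 b.
have := theta_expE 1 9 c; have := theta_expE 1 9 d.
(* With the quadratic parts opaque the exponent formulas are linear, and the residue modulo 5 is
   within reach of [lia]. *)
set aa := a * a - a; set bb := b * b - b; set cc := c * c - c; set dd := d * d - d.
move=> Ed Ec Eb Ea.
have kE : a + b + c + d = 5 * k (a, b, c, d) + 2 by rewrite /k; lia.
move: kE; rewrite /k; set j := (_ %/ 5)%Z => kE.
(* [k] is invariant under [t], which makes [t] an involution; the first coordinate changes by
   [1 + 4 j - 2 a], an odd number. *)
have -> : 1 + 4 * j - a + (1 + 2 * j - b) + (1 + 2 * j - c) + (1 + 2 * j - d) - 2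
  = a + b + c + d - 2 by lia.
rewrite -/j; split; last by lia.
  have := theta_expE 1 4 (1 + 4 * j - a); have := theta_expE 1 9 (1 + 2 * j - b).
  have := theta_expE 1 9 (1 + 2 * j - c); have := theta_expE 1 9 (1 + 2 * j - d).
  (* After eliminating [a], preservation of the exponent is a polynomial identity in [b], [c], [d],
     [j]. *)
  have aE : a = 5 * j + 2 - b - c - d by lia.
  move=> Ed' Ec' Eb' Ea'.
  suff : 2 * (theta_exp 1 4 (1 + 4 * j - a))%:Z + 2 * (theta_exp 1 9 (1 + 2 * j - b))%:Z
    + 2 * (theta_exp 1 9 (1 + 2 * j - c))%:Z + 2 * (theta_exp 1 9 (1 + 2 * j - d))%:Z =
    2 * (theta_exp 1 4 a)%:Z + 2 * (theta_exp 1 9 b)%:Z + 2 * (theta_exp 1 9 c)%:Z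
    + 2 * (theta_exp 1 9 d)%:Z by lia.
  rewrite Ea' Eb' Ec' Ed' Ea Eb Ec Ed /aa /bb /cc /dd aE !PoszD.
  by ring.
by congr (_, _, _, _); lia.
Qed.

(* The same form at [x = 10 a - 1], [y = 5 b - 1], and the vector (4, -1, -1, -1):
   modulo 5 the exponent is [2 (a - b - c - d)], and [a - b - c - d = 5 k + 3]. *)
Lemma theta_sum_h_coef_eq0 N i : (i <= N)%N -> i = 1 %[mod 5] ->
  (theta_sum 2 3 (-1) N * theta_sum 3 7 1 N ^+ 3)`_i = 0.
Proof.
move=> iN i1.
pose k (x : int * int * int * int) :=
  let: (a, b, c, d) := x in ((a - b - c - d - 3) %/ 5)%Z.
pose t (x : int * int * int * int) :=
  let: (a, b, c, d) := x in
  (3 + 4 * k x - a, - 1 - 2 * k x - b, - 1 - 2 * k x - c, - 1 - 2 * k x - d).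
apply: (@theta_sum4_coef_eq0 _ _ _ _ _ _ _ _ _ _ t) => // -[[[a b] c] d] /= xi.
have := theta_expE 2 3 a; have := theta_expE 3 7 b.
have := theta_expE 3 7 c; have := theta_expE 3 7 d.
set aa := a * a - a; set bb := b * b - b; set cc := c * c - c; set dd := d * d - d.
move=> Ed Ec Eb Ea.
have kE : a - b - c - d = 5 * k (a, b, c, d) + 3 by rewrite /k; lia.
move: kE; rewrite /k; set j := (_ %/ 5)%Z => kE.
(* Again [k] is invariant; the first coordinate changes by the odd number [3 + 4 j - 2 a]. *)
have -> : 3 + 4 * j - a - (- 1 - 2 * j - b) - (- 1 - 2 * j - c) - (- 1 - 2 * j - d) - 3
  = a - b - c - d - 3 by lia.
rewrite -/j; split; last by lia.
  have := theta_expE 2 3 (3 + 4 * j - a); have := theta_expE 3 7 (- 1 - 2 * j - b).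
  have := theta_expE 3 7 (- 1 - 2 * j - c); have := theta_expE 3 7 (- 1 - 2 * j - d).
  have aE : a = 5 * j + 3 + b + c + d by lia.
  move=> Ed' Ec' Eb' Ea'.
  suff : 2 * (theta_exp 2 3 (3 + 4 * j - a))%:Z + 2 * (theta_exp 3 7 (- 1 - 2 * j - b))%:Z
    + 2 * (theta_exp 3 7 (- 1 - 2 * j - c))%:Z + 2 * (theta_exp 3 7 (- 1 - 2 * j - d))%:Z =
    2 * (theta_exp 2 3 a)%:Z + 2 * (theta_exp 3 7 b)%:Z + 2 * (theta_exp 3 7 c)%:Z
    + 2 * (theta_exp 3 7 d)%:Z by lia.
  rewrite Ea' Eb' Ec' Ed' Ea Eb Ec Ed /aa /bb /cc /dd aE !PoszD.
  by ring.
by congr (_, _, _, _); lia.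
Qed.

(** * From power series to polynomial coefficients *)

Section SmallProducts.
Variables (R : realType) (r : R) (x : nat -> R).
Hypotheses (r0 : 0 < r) (r3 : r <= 3^-1).
Hypothesis x_le : forall k, `|x k| <= r ^+ k.+1.

Let P (n : nat) : R := \prod_(0 <= k < n) (1 + x k).

Let PS n : P n.+1 = P n * (1 + x n).
Proof. by rewrite /P big_nat_recr. Qed.

(** Subtracting [r^n] makes the bound inductive: with [e = r^n], [(2 - e)(1 + r e) <= 2 - r e]
    amounts to [3 r <= 1 + r e], which holds as [r <= 1/3]. *)
Lemma small_prod_le n : `|P n| <= 2 - r ^+ n.
Proof.
have r3' : 3 * r <= 1 by move: r3; lra.
elim: n => [|n IHn]; first by rewrite /P big_geq // normr1 expr0; lra.
have rn : 0 < r ^+ n by rewrite exprn_gt0.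
rewrite PS normrM exprS.
have : `|1 + x n| <= 1 + r * r ^+ n.
  by apply: le_trans (ler_normD _ _) _; rewrite normr1 lerD2l -exprS.
move: IHn; set p := `|P n|; set y := `|1 + x n|; set e := r ^+ n in rn *.
have p0 : 0 <= p by exact: normr_ge0.
have y0 : 0 <= y by exact: normr_ge0.
by move=> pe ye; apply: le_trans (ler_pM p0 y0 pe ye) _; nra.
Qed.

Lemma small_prod_step n : `|P n.+1 - P n| <= r ^+ n - r ^+ n.+1.
Proof.
have r3' : 3 * r <= 1 by move: r3; lra.
have rn : 0 < r ^+ n by rewrite exprn_gt0.
have -> : P n.+1 - P n = P n * x n by rewrite PS; ring.
have := small_prod_le n; have := x_le n; rewrite normrM exprS.
have := normr_ge0 (P n); have := normr_ge0 (x n).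
by move=> x0 p0 xe pe; apply: le_trans (ler_pM p0 x0 pe xe) _; nra.
Qed.

Lemma small_prod_dist m n : (m <= n)%N -> `|P n - P m| <= r ^+ m - r ^+ n.
Proof.
elim: n => [|n IHn]; first by rewrite leqn0 => /eqP->; rewrite !subrr normr0.
rewrite leq_eqVlt => /predU1P[->|]; first by rewrite !subrr normr0.
rewrite ltnS => /IHn {}IHn.
have -> : P n.+1 - P m = (P n.+1 - P n) + (P n - P m) by ring.
apply: le_trans (ler_normD _ _) _.
by have := small_prod_step n; lra.
Qed.

(** [P] need not be monotone, but [P n - r^n] is nondecreasing by the telescoping bound, and at most
    2. *)
Lemma small_prod_cvg : cvgn P.
Proof.
have rcvg : (fun n => r ^+ n) @ \oo --> (0 : R).
  by apply: cvg_expr; rewrite ger0_norm ?ltW //; move: r3; lra.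
have -> : P = (fun n => P n - r ^+ n) \+ (fun n => r ^+ n).
  by apply/funext => n /=; rewrite subrK.
apply: is_cvgD; last by apply/cvg_ex; exists 0.
apply: nondecreasing_is_cvgn.
  move=> m n mn; have := small_prod_dist mn; rewrite ler_norml => /andP[+ _].
  by lra.
exists 2 => _ [n _ <-]; have := small_prod_le n; rewrite ler_norml => /andP[_].
by have := exprn_gt0 n r0; lra.
Qed.

Lemma small_prod_lim_dist n : `|limn P - P n| <= r ^+ n.
Proof.
have cvg_dist : (fun m => `|P m - P n|) @ \oo --> `|limn P - P n|.
  by apply: cvg_norm; apply: cvgB; [exact: small_prod_cvg | exact: cvg_cst].
rewrite -(cvg_lim _ cvg_dist) //; apply: limr_le; first by apply/cvg_ex; eexists; exact: cvg_dist.
near=> m; apply: le_trans (small_prod_dist _) _; first by near: m; exact: nbhs_infty_ge.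
by have := exprn_gt0 m r0; lra.
Unshelve. all: by end_near. Qed.

Lemma small_prod_lim_le : `|limn P| <= 2.
Proof.
by have := small_prod_lim_dist 0; rewrite /P big_geq // expr0 !ler_norml; lra.
Qed.

End SmallProducts.

(** * Passage between real and complex limits *)

Section RealPart.
Variable R : realType.
Local Open Scope complex_scope.

Lemma norm_real_complex (y : R) : `|y%:C| = `|y|%:C :> R[i].
Proof. by rewrite normc_def /= expr0n addr0 sqrtr_sqr. Qed.

Lemma cvg_real_complex (v : nat -> R) (l : R) :
  ((fun n => (v n)%:C : (R[i] : numFieldType)) @ \oo -->
     (l%:C : (R[i] : numFieldType))) <-> (v @ \oo --> l).
Proof.
split => /cvgrPdist_lt vl; apply/cvgrPdist_lt => e e0.
  have := vl e%:C; rewrite ltcR => /(_ e0); apply: filterS => n.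
  by rewrite -rmorphB /= norm_real_complex ltcR.
(* A positive element of [R[i]] is real, so complex tolerances reduce to real ones. *)
have e_real : e = (complex.Re e)%:C by rewrite RRe_real // gtr0_real.
have := vl (complex.Re e); rewrite -ltcR -e_real => /(_ e0); apply: filterS => n.
by rewrite -rmorphB /= norm_real_complex e_real ltcR.
Qed.

(** Convergence ensures that both [limn] are genuine limits and not default values. *)
Lemma qpochhammer_real (a q : R) :
  cvgn (fun n => \prod_(0 <= k < n) (1 - a * q ^+ k)) ->
  qpochhammer (a%:C : (R[i] : numFieldType)) q%:C = (qpochhammer a q)%:C.
Proof.
move=> /cvg_real_complex cv; rewrite /qpochhammer -[RHS](cvg_lim _ cv) //.
congr (limn _); apply/funext => n; rewrite rmorph_prod; apply: eq_bigr => k _.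
by rewrite rmorphB rmorphM rmorph1 rmorphXn.
Qed.
End RealPart.

(** * Recovering coefficients from values at small real arguments *)

Section CoefficientIdentification.
Variable R : realType.

(** One constant serves all [r] and [N]; the bound on [F] itself is included to make the notion
    stable under products. *)
Definition approximates (F : R -> R) (p : nat -> {poly int}) : Prop :=
  exists2 C : R, 0 <= C & forall (r : R) N, 0 < r -> r <= 3^-1 ->
    `|F r| <= C /\ `|F r - (map_poly intr (p N)).[r]| <= C * r ^+ N.

(** In [a b - a' b' = a (b - b') + (a - a') b'] with [|b'| <= 2 D], the two errors are at most
    [C D r^N] and [2 C D r^N]; hence [3 C D]. *)
Lemma approximatesM F G p t : approximates F p -> approximates G t ->
  approximates (fun r => F r * G r) (fun N => p N * t N).
Proof.
move=> [C C0 FC] [D D0 GD]; exists (3 * C * D); first by rewrite !mulr_ge0.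
move=> r N r0 r3; have [Fr Fp] := FC r N r0 r3; have [Gr Gt] := GD r N r0 r3.
have rN0 : 0 <= r ^+ N by rewrite exprn_ge0 // ltW.
have rN1 : r ^+ N <= 1 by rewrite exprn_ile1 ?(ltW r0) //; lra.
rewrite rmorphM hornerM normrM.
set a := F r in Fr Fp *; set b := G r in Gr Gt *.
set a' := _.[r] in Fp *; set b' := _.[r] in Gt *.
split.
  apply: le_trans (ler_pM (normr_ge0 _) (normr_ge0 _) Fr Gr) _.
  by have := mulr_ge0 C0 D0; lra.
have b'D : `|b'| <= 2 * D.
  have -> : b' = b - (b - b') by ring.
  apply: le_trans (ler_normB _ _) _.
  by have := ler_wpM2l D0 rN1; lra.
have -> : a * b - a' * b' = a * (b - b') + (a - a') * b' by ring.
apply: le_trans (ler_normD _ _) _; rewrite !normrM.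
have := ler_pM (normr_ge0 _) (normr_ge0 _) Fr Gt.
have := ler_pM (normr_ge0 _) (normr_ge0 _) Fp b'D.
by lra.
Qed.

Section QPochhammer.
Variables (e : R) (b u : nat).
Hypotheses (e1 : `|e| <= 1) (b0 : (0 < b)%N) (u0 : (0 < u)%N).

Let term_le (r : R) k : 0 < r -> r <= 3^-1 ->
  `|- (- (e * r ^+ u) * (r ^+ b) ^+ k)| <= r ^+ k.+1.
Proof.
move=> r0 r3; rewrite mulNr opprK -mulrA -exprM -exprD normrM.
rewrite [X in _ * X]ger0_norm ?exprn_ge0 ?(ltW r0) //.
apply: le_trans (ler_piMl _ e1) _; first by rewrite exprn_ge0 ?(ltW r0).
by rewrite ler_wiXn2l ?(ltW r0) //; [lra|nia].
Qed.

Lemma qpochhammer_cvg (r : R) : 0 < r -> r <= 3^-1 ->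
  cvgn (fun n => \prod_(0 <= k < n) (1 - - (e * r ^+ u) * (r ^+ b) ^+ k)).
Proof.
by move=> r0 r3; apply: (small_prod_cvg r0 r3) => k; exact: term_le.
Qed.

Lemma qpochhammer_approximates (c : {poly int}) : map_poly intr c = e%:P ->
  approximates (fun r => qpochhammer (- (e * r ^+ u)) (r ^+ b))
    (fun N => \prod_(k < N) (1 + c * 'X^(b * k + u))).
Proof.
move=> ce; exists 2 => // r N r0 r3.
have tl k := term_le k r0 r3.
split; first exact: (small_prod_lim_le r0 r3 tl).
have -> : (map_poly intr (\prod_(k < N) (1 + c * 'X^(b * k + u)))).[r] =
    \prod_(0 <= k < N) (1 - - (e * r ^+ u) * (r ^+ b) ^+ k).
  rewrite rmorph_prod horner_prod big_mkord; apply: eq_bigr => k _.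
  rewrite rmorphD rmorph1 rmorphM /= ce map_polyXn !hornerE.
  by rewrite mulNr opprK -mulrA -exprM -exprD addnC.
have := small_prod_lim_dist r0 r3 tl N; have := exprn_gt0 N r0.
by rewrite /qpochhammer; lra.
Qed.

End QPochhammer.

(* Once the lower terms vanish, the term of degree [n] is the whole sum minus its tail,
   and both are [O(r^(n+1))]. *)
Lemma coef_eq0_of_bigO (d : nat -> R) (M C : R) N :
  (forall i, `|d i| <= M * 3 ^+ i) ->
  (forall r : R, 0 < r -> r <= 6^-1 -> exists L, (N <= L)%N /\
     `|\sum_(0 <= i < L) d i * r ^+ i| <= C * r ^+ N) ->
  forall n, (n < N)%N -> d n = 0.
Proof.
move=> dM dO n; have [m] := ubnP n; elim: m n => // m IHm n.
rewrite ltnS => nm nN; apply/eqP; rewrite -normr_le0; apply/ler_addgt0Pl => eps eps0.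
have M0 : 0 <= M by have := dM 0%N; rewrite expr0 mulr1; exact: le_trans.
have C0 : 0 <= C.
  have [|L [_ CL]] := dO 6^-1 _ (lexx _); first by lra.
  have := le_trans (normr_ge0 _) CL.
  by rewrite pmulr_lge0 // exprn_gt0 //; lra.
(* The first two terms, times [r^(n+1)], bound the whole sum and its tail; the 1 makes [K]
   positive. *)
pose K := C + 2 * M * 3 ^+ n.+1 + 1.
have K0 : 0 < K.
  have : 0 <= 2 * M * 3 ^+ n.+1 by rewrite !mulr_ge0 // exprn_ge0.
  by rewrite /K; lra.
pose r := Num.min 6^-1 (eps / K).
have r0 : 0 < r by rewrite lt_min divr_gt0 // andbT; lra.
have r6 : r <= 6^-1 by rewrite ge_min lexx.
have rK : K * r <= eps by rewrite mulrC -ler_pdivlMr // ge_min lexx orbT.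
have [L [NL dL]] := dO r r0 r6.
(* A geometric bound of ratio [3 r <= 1/2]; the subtracted term lets the induction on [l] close. *)
have tail l : `|\sum_(n.+1 <= i < n.+1 + l) d i * r ^+ i| <=
    M * (3 * r) ^+ n.+1 * (2 - 2 * (3 * r) ^+ l).
  have r3 : 0 < 3 * r <= 2^-1 by lra.
  elim: l => [|l IHl]; first by rewrite addn0 big_geq // normr0 expr0; lra.
  rewrite addnS big_nat_recr ?leq_addr //=.
  have dl : `|d (n.+1 + l)%N * r ^+ (n.+1 + l)| <=
      M * (3 * r) ^+ n.+1 * (3 * r) ^+ l.
    rewrite normrM [X in _ * X]ger0_norm ?exprn_ge0 ?(ltW r0) //.
    by rewrite -mulrA -exprD exprMn mulrA ler_wpM2r ?exprn_ge0 ?(ltW r0).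
  apply: le_trans (ler_normD _ _) _; apply: le_trans (lerD IHl dl) _.
  rewrite -mulrDr ler_wpM2l //; first by rewrite mulr_ge0 // exprn_ge0; lra.
  case/andP: r3 => r30 r32; have := exprn_gt0 l r30; rewrite exprS.
  by move: r32; set y := 3 * r; set z := y ^+ l; nra.
have {}tail : `|\sum_(n.+1 <= i < L) d i * r ^+ i| <= 2 * M * 3 ^+ n.+1 * r ^+ n.+1.
  have := tail (L - n.+1)%N; rewrite subnKC; last by lia.
  move/le_trans; apply; rewrite exprMn.
  have : 0 <= (3 * r) ^+ (L - n.+1) by rewrite exprn_ge0; lra.
  set z := (3 * r) ^+ _ => z0.
  have -> : 2 * M * 3 ^+ n.+1 * r ^+ n.+1 = M * (3 ^+ n.+1 * r ^+ n.+1) * 2 by ring.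
  rewrite ler_wpM2l //; last by lra.
  by rewrite !mulr_ge0 ?exprn_ge0 ?(ltW r0).
have sumE : \sum_(0 <= i < L) d i * r ^+ i =
    d n * r ^+ n + \sum_(n.+1 <= i < L) d i * r ^+ i.
  rewrite (big_cat_nat _ _ (n := n)) //=; last by lia.
  rewrite [X in X + _]big_nat_cond big1 ?add0r; last first.
    by move=> i; rewrite andbT => /andP[_ ni]; rewrite IHm ?mul0r //; lia.
  by rewrite big_ltn //; lia.
have rn : 0 < r ^+ n by rewrite exprn_gt0.
rewrite addr0 -(ler_pM2r rn).
have -> : `|d n| * r ^+ n = `|d n * r ^+ n| by rewrite normrM [`|r ^+ n|]gtr0_norm.
have -> : d n * r ^+ n = \sum_(0 <= i < L) d i * r ^+ i -
    \sum_(n.+1 <= i < L) d i * r ^+ i by rewrite sumE addrK.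
apply: le_trans (ler_normB _ _) _; apply: le_trans (lerD dL tail) _.
have : r ^+ N <= r ^+ n.+1 by rewrite ler_wiXn2l ?(ltW r0) //; lra.
move=> /(ler_wpM2l C0) CrN.
apply: le_trans (lerD CrN (lexx _)) _; rewrite -mulrDl [r ^+ n.+1]exprS mulrA ler_pM2r //.
by apply: le_trans rK; rewrite ler_pM2r // /K; lra.
Qed.

Lemma coef_of_approximates (F : R -> R) (p : nat -> {poly int}) (g : nat -> int) :
  approximates F p ->
  (forall r : R, 0 < r -> r <= 3^-1 ->
    series (fun n => (g n)%:~R * r ^+ n) @ \oo --> F r) ->
  forall n N, (n < N)%N -> g n = (p N)`_n.
Proof.
move=> [C C0 FC] gF n N nN.
pose d i : R := (g i)%:~R - (map_poly intr (p N))`_i.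
(* Convergence at [1/3] bounds the partial sums by some [M]; a term is a difference of two of them,
   so [|g i| <= 2 M 3^i]. *)
have d_le : exists M, forall i, `|d i| <= M * 3 ^+ i.
  have : cvgn (series (fun n => (g n)%:~R * (3^-1 : R) ^+ n)).
    by apply/cvg_ex; exists (F 3^-1); apply: gF; lra.
  move=> /cvg_seq_bounded/pinfty_ex_gt0[M M0 gM].
  have pB : exists2 B : R, 0 <= B & forall i, `|(map_poly intr (p N))`_i| <= B.
    exists (\sum_(i < size (map_poly intr (p N) : {poly R})) `|(map_poly intr (p N))`_i|).
      exact: sumr_ge0.
    move=> i; case: (ltnP i (size (map_poly intr (p N) : {poly R}))) => [ip|pi].
      by rewrite (bigD1 (Ordinal ip)) //= lerDl sumr_ge0.
    by rewrite nth_default // normr0 sumr_ge0.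
  have [B B0 pB'] := pB.
  exists (2 * M + B) => i; apply: le_trans (ler_normB _ _) _; rewrite mulrDl.
  have p3 : 1 <= 3 ^+ i :> R by rewrite exprn_ege1 //; lra.
  apply: lerD; last by apply: le_trans (pB' i) _; rewrite ler_peMr.
  have := le_trans (ler_normB _ _) (lerD (gM i.+1 I) (gM i I)).
  rewrite /series /= big_nat_recr //= addrAC subrr add0r normrM normrX.
  rewrite [`|3^-1|]ger0_norm ?invr_ge0 // exprVn ler_pdivrMr ?exprn_gt0 //.
  by move/le_trans; apply; rewrite ler_wpM2r ?exprn_ge0 //; lra.
have [M dM] := d_le.
suff : d n = 0.
  by move/eqP; rewrite subr_eq0 coef_map /= eqr_int => /eqP.
(* [C r^N] is the error of the polynomial; the further [r^N] pays for cutting the series at [L]. *)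
apply: (coef_eq0_of_bigO (C := C + 1) dM _ nN) => r r0 r6.
have r3 : r <= 3^-1 by lra.
have [_ Fp] := FC r N r0 r3.
have rN : 0 < r ^+ N by rewrite exprn_gt0.
have /cvgrPdist_lt /(_ _ rN) near_g := gF r r0 r3.
have [L [NL pL gL]] : exists L, [/\ (N <= L)%N, (size (map_poly intr (p N) : {poly R}) <= L)%N &
    `|F r - series (fun n => (g n)%:~R * r ^+ n) L| < r ^+ N].
  near \oo => L; exists L; split; near: L => //; exact: nbhs_infty_ge.
exists L; split => //.
have -> : \sum_(0 <= i < L) d i * r ^+ i =
    series (fun n => (g n)%:~R * r ^+ n) L - (map_poly intr (p N)).[r].
  rewrite /series /= (horner_coef_wide _ pL) -(big_mkord xpredT (fun i => _`_i * r ^+ i)).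
  by rewrite -sumrB; apply: eq_bigr => i _; rewrite mulrBl.
set s := series _ L in gL *; set t := _.[r] in Fp *.
have -> : s - t = (F r - t) - (F r - s) by ring.
apply: le_trans (ler_normB _ _) _; lra.
Unshelve. all: by end_near. Qed.
End CoefficientIdentification.

(** * Coefficients of the analytic product of theta factors *)

Section ThetaProductCoefficients.
Variables (R : realType) (u w u' w' : nat).
Hypotheses (u0 : (0 < u)%N) (w0 : (0 < w)%N) (u'0 : (0 < u')%N) (w'0 : (0 < w')%N).
Local Open Scope complex_scope.

Lemma theta_prod_approximates (a b : nat) (e : R) (c : {poly int}) :
  (0 < a)%N -> (0 < b)%N -> `|e| <= 1 -> map_poly intr c = e%:P ->
  approximates (fun r => qpochhammer (- (e * r ^+ a)) (r ^+ (a + b))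
                       * qpochhammer (- (e * r ^+ b)) (r ^+ (a + b)))
    (theta_prod a b c).
Proof.
move=> a0 b0 e1 ce; have ab0 : (0 < a + b)%N by lia.
have -> : theta_prod a b c = fun N => \prod_(k < N) (1 + c * 'X^((a + b) * k + a)) *
    \prod_(k < N) (1 + c * 'X^((a + b) * k + b)).
  by apply/funext => N; rewrite -big_split.
by apply: approximatesM; apply: qpochhammer_approximates.
Qed.

Lemma qpochhammers_pair_real (a b : nat) (e r : R) :
  (0 < a)%N -> (0 < b)%N -> `|e| <= 1 -> 0 < r -> r <= 3^-1 ->
  qpochhammers [:: (- (e * r ^+ a))%:C; (- (e * r ^+ b))%:C] (r ^+ (a + b))%:C =
  (qpochhammer (- (e * r ^+ a)) (r ^+ (a + b))
   * qpochhammer (- (e * r ^+ b)) (r ^+ (a + b)))%:C :> (R[i] : numFieldType).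
Proof.
move=> a0 b0 e1 r0 r3; have ab0 : (0 < a + b)%N by lia.
rewrite /qpochhammers big_cons big_seq1.
rewrite (qpochhammer_real (qpochhammer_cvg e1 ab0 a0 r0 r3)).
rewrite (qpochhammer_real (qpochhammer_cvg e1 ab0 b0 r0 r3)).
by rewrite rmorphM.
Qed.

(** The values at real [0 < r <= 1/3] already determine the coefficients, so the complex identity is
    used only there. *)
Lemma generating_function_coef (g : nat -> int) :
  generating_function g (fun q : R[i] =>
    qpochhammers [:: q ^+ u; q ^+ w] (q ^+ (u + w))
    * qpochhammers [:: - q ^+ u'; - q ^+ w'] (q ^+ (u' + w')) ^+ 3) ->
  forall n N, (n < N)%N ->
    g n = (theta_prod u w (-1) N * theta_prod u' w' 1 N ^+ 3)`_n.
Proof.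
move=> hg.
have N1 : map_poly intr (-1 : {poly int}) = (-1)%:P :> {poly R}.
  by rewrite rmorphN1 polyCN.
have P1 : map_poly intr (1 : {poly int}) = 1%:P :> {poly R} by rewrite rmorph1.
have nN1 : `|-1| <= 1 :> R by rewrite normrN1.
have nP1 : `|1| <= 1 :> R by rewrite normr1.
have A1 := theta_prod_approximates u0 w0 nN1 N1.
have A2 := theta_prod_approximates u'0 w'0 nP1 P1.
apply: (coef_of_approximates (approximatesM A1 (approximatesM A2 (approximatesM A2 A2)))).
move=> r r0 r3; apply/cvg_real_complex.
pose Q (e : R) a b := qpochhammer (- (e * r ^+ a)) (r ^+ (a + b))
                    * qpochhammer (- (e * r ^+ b)) (r ^+ (a + b)).
rewrite -[X in X%:C]/(Q (-1) u w * (Q 1 u' w' * (Q 1 u' w' * Q 1 u' w'))).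
have r1 : `|r%:C| < 1 :> R[i].
  by rewrite norm_real_complex (ltcR _ 1) gtr0_norm //; lra.
have -> : (fun n => (series (fun k => (g k)%:~R * r ^+ k) n)%:C) =
    series (fun k => (g k)%:~R * r%:C ^+ k) :> (nat -> (R[i] : numFieldType)).
  apply/funext => n; rewrite /series /= rmorph_sum; apply: eq_bigr => k _.
  by rewrite rmorphM rmorphXn /= rmorph_int.
have XE a : r%:C ^+ a = (r ^+ a)%:C :> R[i] by rewrite rmorphXn.
(* Both kinds of argument are brought to the form [- (e r^a)], with [e = -1] here and [e = 1]
   next. *)
have XN1 a : r%:C ^+ a = (- (-1 * r ^+ a))%:C :> R[i] by rewrite mulN1r opprK XE.
have X1 a : - r%:C ^+ a = (- (1 * r ^+ a))%:C :> R[i] by rewrite mul1r rmorphN XE.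
have := hg _ r1; cbv beta.
have -> : qpochhammers [:: r%:C ^+ u; r%:C ^+ w] (r%:C ^+ (u + w)) = (Q (-1) u w)%:C :> R[i].
  by rewrite (XN1 u) (XN1 w) (XE (u + w)%N); exact: qpochhammers_pair_real.
have -> : qpochhammers [:: - r%:C ^+ u'; - r%:C ^+ w'] (r%:C ^+ (u' + w')) =
    (Q 1 u' w')%:C :> R[i].
  by rewrite (X1 u') (X1 w') (XE (u' + w')%N); exact: qpochhammers_pair_real.
by rewrite -[(Q 1 u' w')%:C ^+ 3]rmorphXn -rmorphM !exprS expr0 mulr1.
Qed.

End ThetaProductCoefficients.

Local Open Scope complex_scope.
Local Open Scope ring_scope.

Theorem theorem11 (R : realType) (g h : nat -> int)
  (hg : generating_function g (fun q : R[i] =>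
          qpochhammers [:: q; q ^+ 4] (q ^+ 5)
          * qpochhammers [:: - q; - q ^+ 9] (q ^+ 10) ^+ 3))
  (hh : generating_function h (fun q : R[i] =>
          qpochhammers [:: q ^+ 2; q ^+ 3] (q ^+ 5)
          * qpochhammers [:: - q ^+ 3; - q ^+ 7] (q ^+ 10) ^+ 3)) :
  (forall n : nat, g (5 * n + 2)%N = 0) /\ (forall n : nat, h (5 * n + 1)%N = 0).
Proof.
split=> n.
  (* Working modulo [X^m] with [m = 5 n + 3] covers the index [5 n + 2]; the truncation [2 m] is the
     one required by [theta_prod4_coef_eq0]. *)
  rewrite (generating_function_coef (u := 1) (w := 4) (u' := 1) (w' := 9)
             _ _ _ _ hg (N := 2 * (5 * n + 3))) //; last by lia.
  apply: (theta_prod4_coef_eq0 (c := 2)) => //; [|lia|lia].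
  by move=> i im i2; apply: theta_sum_g_coef_eq0 => //; lia.
rewrite (generating_function_coef (u := 2) (w := 3) (u' := 3) (w' := 7)
           _ _ _ _ hh (N := 2 * (5 * n + 3))) //; last by lia.
apply: (theta_prod4_coef_eq0 (c := 1)) => //; [|lia|lia].
by move=> i im i1; apply: theta_sum_h_coef_eq0 => //; lia.
Qed.
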